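(* Let $\Psi=(G:\mathscr D\to\mathscr C,\ F:\mathscr C\to\mathscr D)$ be a pair of adjoint functors, with $G$ left adjoint to $F$, let $(\mathscr C,S)$ and $(\mathscr D,T)$ be monads such that the Eilenberg-Moore categories $\mathscr C^S$ and $\mathscr D^T$ both contain reflexive coequalizers, and let $\phi=(\phi_G,\phi_F):(\mathscr C,S)\to(\mathscr D,T)$ be a $\Psi$-morphism of monads. Let $\hat\phi_G:\mathscr D^T\to\mathscr C^S$ be the functor defined by the coequalizer construction in the context. Then the following are equivalent. (1) There exists a functor $Q:\mathscr D\to\mathscr C$ such that there are isomorphisms in $\mathscr C$ $$\pi(S)\big(\hat\phi_G(x,\lambda_x)\big)\cong Q(x)\qquad \text{for all } (x,\lambda_x)\in\mathscr D^T,$$ natural with respect to morphisms in $\mathscr D^T$. (2) The functor $SG:\mathscr D\to\mathscr C$, together with the natural transformation $\nu':SGT\xrightarrow{S\phi_G}S^2G\xrightarrow{\mu(S)G}SG$, is isomorphic, in the category $Mod_T^{\mathscr C}$ of $T$-modules taking values in $\mathscr C$, to a free $T$-module with values in $\mathscr C$.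
   Context: Monads and algebras. A monad $(\mathscr C,S)$ is an endofunctor $S:\mathscr C\to\mathscr C$ with natural transformations $\mu(S):S^2\to S$ and $\eta(S):1\to S$ satisfying the usual associativity and unit conditions. An $S$-algebra $(y,\lambda_y)$ is an object $y\in\mathscr C$ with $\lambda_y:Sy\to y$ such that $\lambda_y\circ\mu(S)y=\lambda_y\circ S\lambda_y$ and $\lambda_y\circ\eta(S)y=1_y$; with the evident morphisms these form the Eilenberg-Moore category $\mathscr C^S$. $\pi(S):\mathscr C^S\to\mathscr C$ is the forgetful functor. The same notation is used for $(\mathscr D,T)$. Adjunction notation. For $f:Gx\to y$ in $\mathscr C$, $f^R:x\to Fy$ denotes the corresponding morphism in $\mathscr D$; for $g:x\to Fy$ in $\mathscr D$, $g^L:Gx\to y$ denotes the corresponding morphism in $\mathscr C$. $\Psi$-morphism of monads. A $\Psi$-morphism $\phi=(\phi_G,\phi_F):(\mathscr C,S)\to(\mathscr D,T)$ is a pair of natural transformations $\phi_G:GT\to SG$ and $\phi_F:TF\to FS$ such that: (i) $\phi_G\circ G\mu(T)=\mu(S)G\circ S\phi_G\circ\phi_GT$ as maps $GT^2\to SG$, and $\phi_G\circ G\eta(T)=\eta(S)G$; (ii) $\phi_F\circ\mu(T)F=F\mu(S)\circ\phi_FS\circ T\phi_F$ as maps $T^2F\to FS$, and $\phi_F\circ\eta(T)F=F\eta(S)$; (iii) for every morphism $f:Gx\to y$ in $\mathscr C$, $\phi_F(y)^L\circ GT(f^R)=Sf\circ\phi_G(x)$ as morphisms $GTx\to Sy$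 (equivalently, $\phi_F(y)\circ T(f^R)=FSf\circ\phi_G(x)^R$ as morphisms $Tx\to FSy$). The functor $\hat\phi_G$. For $(x,\lambda_x)\in\mathscr D^T$, the objects $SGTx$ and $SGx$ carry free $S$-algebra structures $\mu(S)GTx$ and $\mu(S)Gx$, and the two arrows $$(\mu(S)Gx)\circ(S\phi_G(x)),\quad SG\lambda_x\ :\ SGTx\rightrightarrows SGx$$ form a reflexive pair in $\mathscr C^S$ (with common section $SG\eta(T)x$). $\hat\phi_G(x,\lambda_x)$ is the coequalizer of this pair in $\mathscr C^S$; on a morphism $h$ of $T$-algebras, $\hat\phi_G(h)$ is the map induced on coequalizers by $SGTh$ and $SGh$. $T$-modules. A $T$-module taking values in $\mathscr C$ is a pair $(P,\nu(P))$ with $P:\mathscr D\to\mathscr C$ a functor and $\nu(P):PT\to P$ a natural transformation such that $\nu(P)\circ\nu(P)T=\nu(P)\circ P\mu(T)$ and $\nu(P)\circ P\eta(T)=id_P$. A morphism $(P,\nu(P))\to(P',\nu(P'))$ is a natural transformation $\alpha:P\to P'$ with $\nu(P')\circ(\alpha T)=\alpha\circ\nu(P)$. These form the category $Mod_T^{\mathscr C}$. The pair $(SG,\nu')$ is an object of $Mod_T^{\mathscr C}$. The free $T$-module in $\mathscr C$ associated to a functor $P:\mathscr D\to\mathscr C$ is $(PT,P\mu(T))$. *)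

(* Defs.v *)
From Stdlib Require Import ProofIrrelevance FunctionalExtensionality.

Set Implicit Arguments.
Unset Strict Implicit.
Unset Printing Implicit Defensive.

Declare Scope cat_scope.
Delimit Scope cat_scope with cat.
Open Scope cat_scope.

Record Category := {
  Ob :> Type;
  Hom : Ob -> Ob -> Type;
  idm : forall x, Hom x x;
  comp : forall x y z, Hom y z -> Hom x y -> Hom x z;
  comp_assoc : forall w x y z (h : Hom y z) (g : Hom x y) (f : Hom w x),
    comp h (comp g f) = comp (comp h g) f;
  comp_idl : forall x y (f : Hom x y), comp (idm y) f = f;
  comp_idr : forall x y (f : Hom x y), comp f (idm x) = f
}.

Arguments Hom {c} x y.
Arguments idm {c} x.
Arguments comp {c x y z} g f : rename.

Notation "g ∘ f" := (comp g f) (at level 40, left associativity) : cat_scope.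

Definition is_iso (C : Category) (x y : C) (f : Hom x y) : Prop :=
  exists g : Hom y x, g ∘ f = idm x /\ f ∘ g = idm y.

Definition isomorphic (C : Category) (x y : C) : Prop :=
  exists f : Hom x y, is_iso f.

Arguments isomorphic : clear implicits.

Record Functor (C D : Category) := {
  fobj :> C -> D;
  fmap : forall x y, Hom x y -> Hom (fobj x) (fobj y);
  fmap_id : forall x, fmap (idm x) = idm (fobj x);
  fmap_comp : forall x y z (g : Hom y z) (f : Hom x y),
    fmap (g ∘ f) = fmap g ∘ fmap f
}.

Arguments fmap {C D} f {x y} h : rename.

Definition id_functor (C : Category) : Functor C C :=
  {| fobj := fun x => x;
     fmap := fun x y f => f;
     fmap_id := fun x => eq_refl;
     fmap_comp := fun x y z g f => eq_refl |}.

Arguments id_functor : clear implicits.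

Lemma fcomp_id (C D E : Category) (H : Functor D E) (K : Functor C D) (x : C) :
  fmap H (fmap K (idm x)) = idm (H (K x)).
Proof. now rewrite !fmap_id. Qed.

Lemma fcomp_comp (C D E : Category) (H : Functor D E) (K : Functor C D)
  (x y z : C) (g : Hom y z) (f : Hom x y) :
  fmap H (fmap K (g ∘ f)) = fmap H (fmap K g) ∘ fmap H (fmap K f).
Proof. now rewrite !fmap_comp. Qed.

Definition fcomp (C D E : Category) (H : Functor D E) (K : Functor C D) :
  Functor C E :=
  {| fobj := fun x => H (K x);
     fmap := fun x y f => fmap H (fmap K f);
     fmap_id := fcomp_id H K;
     fmap_comp := fcomp_comp H K |}.

Notation "H ○ K" := (fcomp H K) (at level 40, left associativity) : cat_scope.

Record NatTrans (C D : Category) (H K : Functor C D) := {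
  ntc :> forall x, Hom (H x) (K x);
  ntc_nat : forall x y (f : Hom x y), ntc y ∘ fmap H f = fmap K f ∘ ntc x
}.

Lemma NatTrans_eq (C D : Category) (H K : Functor C D) (a b : NatTrans H K) :
  (forall x, a x = b x) -> a = b.
Proof.
destruct a as [a na], b as [b nb]; simpl; intros E.
assert (a = b) as <- by now apply functional_extensionality_dep.
f_equal; apply proof_irrelevance.
Qed.

(** [adjR f] and [adjL g] are $f^R$ and $g^L$; naturality of [adjL] follows. *)
Record Adjunction (C D : Category) (G : Functor D C) (F : Functor C D) := {
  adjR : forall x y, Hom (G x) y -> Hom x (F y);
  adjL : forall x y, Hom x (F y) -> Hom (G x) y;
  adjRK : forall x y (f : Hom (G x) y), adjL (adjR f) = f;
  adjLK : forall x y (g : Hom x (F y)), adjR (adjL g) = g;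
  adjR_natl : forall x x' y (u : Hom x' x) (f : Hom (G x) y),
    adjR (f ∘ fmap G u) = adjR f ∘ u;
  adjR_natr : forall x y y' (v : Hom y y') (f : Hom (G x) y),
    adjR (v ∘ f) = fmap F v ∘ adjR f
}.

Arguments adjR {C D G F} a {x y} f : rename.
Arguments adjL {C D G F} a {x y} g : rename.

Record Monad (C : Category) := {
  mfun :> Functor C C;
  mu : NatTrans (mfun ○ mfun) mfun;
  eta : NatTrans (id_functor C) mfun;
  mu_assoc : forall x, mu x ∘ mu (mfun x) = mu x ∘ fmap mfun (mu x);
  mu_etal : forall x, mu x ∘ eta (mfun x) = idm (mfun x);
  mu_etar : forall x, mu x ∘ fmap mfun (eta x) = idm (mfun x)
}.

Arguments mu {C} S : rename.
Arguments eta {C} S : rename.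

Record Algebra (C : Category) (S : Monad C) := {
  carrier : C;
  action : Hom (S carrier) carrier;
  action_mu : action ∘ mu S carrier = action ∘ fmap S action;
  action_eta : action ∘ eta S carrier = idm carrier
}.

Record AlgHom (C : Category) (S : Monad C) (X Y : Algebra S) := {
  amor :> Hom (carrier X) (carrier Y);
  amorP : amor ∘ action X = action Y ∘ fmap S amor
}.

Lemma AlgHom_eq (C : Category) (S : Monad C) (X Y : Algebra S)
  (f g : AlgHom X Y) : amor f = amor g -> f = g.
Proof.
destruct f as [f pf], g as [g pg]; simpl; intros <-.
f_equal; apply proof_irrelevance.
Qed.

Section EilenbergMoore.
Variables (C : Category) (S : Monad C).

Lemma em_idP (X : Algebra S) :
  idm (carrier X) ∘ action X = action X ∘ fmap S (idm (carrier X)).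
Proof. now rewrite fmap_id, comp_idl, comp_idr. Qed.

Lemma em_compP (X Y Z : Algebra S) (g : AlgHom Y Z) (f : AlgHom X Y) :
  (g ∘ f) ∘ action X = action Z ∘ fmap S (g ∘ f).
Proof.
now rewrite <- comp_assoc, amorP, comp_assoc, amorP, fmap_comp, comp_assoc.
Qed.

Definition em_id (X : Algebra S) : AlgHom X X := {| amorP := em_idP X |}.

Definition em_comp (X Y Z : Algebra S) (g : AlgHom Y Z) (f : AlgHom X Y) :
  AlgHom X Z := {| amorP := em_compP g f |}.

Lemma em_assoc (W X Y Z : Algebra S)
  (h : AlgHom Y Z) (g : AlgHom X Y) (f : AlgHom W X) :
  em_comp h (em_comp g f) = em_comp (em_comp h g) f.
Proof. apply AlgHom_eq, comp_assoc. Qed.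

Lemma em_idl (X Y : Algebra S) (f : AlgHom X Y) : em_comp (em_id Y) f = f.
Proof. apply AlgHom_eq, comp_idl. Qed.

Lemma em_idr (X Y : Algebra S) (f : AlgHom X Y) : em_comp f (em_id X) = f.
Proof. apply AlgHom_eq, comp_idr. Qed.

Definition EM : Category :=
  {| Ob := Algebra S;
     Hom := @AlgHom C S;
     idm := em_id;
     comp := em_comp;
     comp_assoc := em_assoc;
     comp_idl := em_idl;
     comp_idr := em_idr |}.

Definition em_forget : Functor EM C :=
  {| fobj := fun X : EM => carrier X;
     fmap := fun (X Y : EM) (f : Hom X Y) => amor f;
     fmap_id := fun X => eq_refl;
     fmap_comp := fun X Y Z g f => eq_refl |}.

Definition free_alg (x : C) : EM :=
  {| carrier := S x;
     action := mu S x;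
     action_mu := mu_assoc S x;
     action_eta := mu_etal S x |}.

Lemma free_alg_mapP (x y : C) (f : Hom x y) :
  fmap S f ∘ mu S x = mu S y ∘ fmap S (fmap S f).
Proof. symmetry; apply (ntc_nat (mu S)). Qed.

Definition free_alg_map (x y : C) (f : Hom x y) :
  Hom (free_alg x) (free_alg y) :=
  @Build_AlgHom C S (free_alg x) (free_alg y) (fmap S f) (free_alg_mapP f).

End EilenbergMoore.

Record Coequalizer (C : Category) (a b : C) (f g : Hom a b) := {
  coeq : C;
  coeq_proj : Hom b coeq;
  coeq_eq : coeq_proj ∘ f = coeq_proj ∘ g;
  coeq_desc : forall z (k : Hom b z), k ∘ f = k ∘ g -> Hom coeq z;
  coeq_descK : forall z (k : Hom b z) (e : k ∘ f = k ∘ g),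
    coeq_desc e ∘ coeq_proj = k;
  coeq_uniq : forall z (u v : Hom coeq z),
    u ∘ coeq_proj = v ∘ coeq_proj -> u = v
}.

Definition is_reflexive_pair (C : Category) (a b : C) (f g : Hom a b) : Prop :=
  exists s : Hom b a, f ∘ s = idm b /\ g ∘ s = idm b.

(** Chosen coequalizers rather than mere existence, since [phi_hat] below is
    built from them; nothing is assumed about how they are chosen. *)
Definition ReflexiveCoequalizers (C : Category) : Type :=
  forall (a b : C) (f g : Hom a b), is_reflexive_pair f g -> Coequalizer f g.

Record PsiMorphism (C D : Category) (G : Functor D C) (F : Functor C D)
  (Psi : Adjunction G F) (S : Monad C) (T : Monad D) := {
  phiG : NatTrans (G ○ T) (S ○ G);
  phiF : NatTrans (T ○ F) (F ○ S);
  phiG_mu : forall x,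
    phiG x ∘ fmap G (mu T x) = mu S (G x) ∘ fmap S (phiG x) ∘ phiG (T x);
  phiG_eta : forall x, phiG x ∘ fmap G (eta T x) = eta S (G x);
  phiF_mu : forall y,
    phiF y ∘ mu T (F y) = fmap F (mu S y) ∘ phiF (S y) ∘ fmap T (phiF y);
  phiF_eta : forall y, phiF y ∘ eta T (F y) = fmap F (eta S y);
  phi_compat : forall x y (f : Hom (G x) y),
    adjL Psi (phiF y) ∘ fmap G (fmap T (adjR Psi f)) = fmap S f ∘ phiG x
}.

Record TModule (D : Category) (T : Monad D) (C : Category) := {
  mod_fun : Functor D C;
  mod_act : NatTrans (mod_fun ○ T) mod_fun;
  mod_act_mu : forall x,
    mod_act x ∘ mod_act (T x) = mod_act x ∘ fmap mod_fun (mu T x);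
  mod_act_eta : forall x,
    mod_act x ∘ fmap mod_fun (eta T x) = idm (mod_fun x)
}.

Arguments mod_fun {D T C} t : rename.
Arguments mod_act {D T C} t : rename.

Record TModHom (D : Category) (T : Monad D) (C : Category)
  (P P' : TModule T C) := {
  modmor : NatTrans (mod_fun P) (mod_fun P');
  modmorP : forall x, mod_act P' x ∘ modmor (T x) = modmor x ∘ mod_act P x
}.

Lemma TModHom_eq (D : Category) (T : Monad D) (C : Category)
  (P P' : TModule T C) (a b : TModHom P P') :
  (forall x, modmor a x = modmor b x) -> a = b.
Proof.
destruct a as [a pa], b as [b pb]; simpl; intros E.
assert (a = b) as <- by now apply NatTrans_eq.
f_equal; apply proof_irrelevance.
Qed.

Section ModuleCategory.
Variables (D : Category) (T : Monad D) (C : Category).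

Lemma id_nat (H : Functor D C) (x y : D) (f : Hom x y) :
  idm (H y) ∘ fmap H f = fmap H f ∘ idm (H x).
Proof. now rewrite comp_idl, comp_idr. Qed.

Definition id_trans (H : Functor D C) : NatTrans H H :=
  {| ntc := fun x => idm (H x); ntc_nat := id_nat H |}.

Lemma vcomp_nat (H K L : Functor D C) (b : NatTrans K L) (a : NatTrans H K)
  (x y : D) (f : Hom x y) :
  (b y ∘ a y) ∘ fmap H f = fmap L f ∘ (b x ∘ a x).
Proof.
now rewrite <- comp_assoc, ntc_nat, comp_assoc, ntc_nat, comp_assoc.
Qed.

Definition vcomp (H K L : Functor D C) (b : NatTrans K L) (a : NatTrans H K) :
  NatTrans H L :=
  {| ntc := fun x => b x ∘ a x; ntc_nat := vcomp_nat b a |}.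

Lemma mod_idP (P : TModule T C) (x : D) :
  mod_act P x ∘ id_trans (mod_fun P) (T x) =
  id_trans (mod_fun P) x ∘ mod_act P x.
Proof. simpl; now rewrite comp_idl, comp_idr. Qed.

Definition mod_id (P : TModule T C) : TModHom P P :=
  {| modmorP := mod_idP P |}.

Lemma mod_compP (P P' P'' : TModule T C) (b : TModHom P' P'')
  (a : TModHom P P') (x : D) :
  mod_act P'' x ∘ vcomp (modmor b) (modmor a) (T x) =
  vcomp (modmor b) (modmor a) x ∘ mod_act P x.
Proof.
pose proof (modmorP a x) as Ea; pose proof (modmorP b x) as Eb.
simpl in *; now rewrite comp_assoc, Eb, <- !comp_assoc, Ea.
Qed.

Definition mod_comp (P P' P'' : TModule T C) (b : TModHom P' P'')
  (a : TModHom P P') : TModHom P P'' :=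
  {| modmorP := mod_compP b a |}.

Lemma mod_assoc (P0 P1 P2 P3 : TModule T C) (c : TModHom P2 P3)
  (b : TModHom P1 P2) (a : TModHom P0 P1) :
  mod_comp c (mod_comp b a) = mod_comp (mod_comp c b) a.
Proof. apply TModHom_eq; intro x; apply comp_assoc. Qed.

Lemma mod_idl (P P' : TModule T C) (a : TModHom P P') :
  mod_comp (mod_id P') a = a.
Proof. apply TModHom_eq; intro x; apply comp_idl. Qed.

Lemma mod_idr (P P' : TModule T C) (a : TModHom P P') :
  mod_comp a (mod_id P) = a.
Proof. apply TModHom_eq; intro x; apply comp_idr. Qed.

Definition ModCat : Category :=
  {| Ob := TModule T C;
     Hom := @TModHom D T C;
     idm := mod_id;
     comp := mod_comp;
     comp_assoc := mod_assoc;
     comp_idl := mod_idl;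
     comp_idr := mod_idr |}.

Section FreeModule.
Variable P : Functor D C.

Lemma free_module_nat (x y : D) (f : Hom x y) :
  fmap P (mu T y) ∘ fmap (P ○ T ○ T) f =
  fmap (P ○ T) f ∘ fmap P (mu T x).
Proof.
simpl; rewrite <- !fmap_comp; f_equal; exact (ntc_nat (mu T) f).
Qed.

Definition free_module_act : NatTrans (P ○ T ○ T) (P ○ T) :=
  {| ntc := fun x => fmap P (mu T x) : Hom ((P ○ T ○ T) x) ((P ○ T) x);
     ntc_nat := free_module_nat |}.

Lemma free_module_mu (x : D) :
  free_module_act x ∘ free_module_act (T x) =
  free_module_act x ∘ fmap (P ○ T) (mu T x).
Proof. simpl; rewrite <- !fmap_comp; f_equal; apply mu_assoc. Qed.

Lemma free_module_eta (x : D) :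
  free_module_act x ∘ fmap (P ○ T) (eta T x) = idm ((P ○ T) x).
Proof.
pose proof (mu_etar T x) as E.
simpl in *; rewrite <- fmap_comp, E; apply fmap_id.
Qed.

Definition free_module : ModCat :=
  {| mod_fun := P ○ T;
     mod_act := free_module_act;
     mod_act_mu := free_module_mu;
     mod_act_eta := free_module_eta |}.

End FreeModule.

End ModuleCategory.

Section PhiHat.
Variables (C D : Category) (G : Functor D C) (F : Functor C D).
Variables (Psi : Adjunction G F) (S : Monad C) (T : Monad D).
Variable phi : PsiMorphism Psi S T.

Definition nu' (x : D) : Hom (S (G (T x))) (S (G x)) :=
  mu S (G x) ∘ fmap S (phiG phi x).

Lemma nu'_nat (x y : D) (f : Hom x y) :
  nu' y ∘ fmap (S ○ G ○ T) f = fmap (S ○ G) f ∘ nu' x.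
Proof.
unfold nu'; simpl.
rewrite <- comp_assoc, <- fmap_comp.
pose proof (ntc_nat (phiG phi) f) as E; simpl in E; rewrite E.
rewrite fmap_comp, !comp_assoc; f_equal.
exact (ntc_nat (mu S) (fmap G f)).
Qed.

Definition nu'_trans : NatTrans (S ○ G ○ T) (S ○ G) :=
  {| ntc := nu' : forall x, Hom ((S ○ G ○ T) x) ((S ○ G) x);
     ntc_nat := nu'_nat |}.

Lemma nu'_mu (x : D) :
  nu'_trans x ∘ nu'_trans (T x) = nu'_trans x ∘ fmap (S ○ G) (mu T x).
Proof.
pose proof (phiG_mu phi x) as E; pose proof (mu_assoc S (G x)) as A.
pose proof (ntc_nat (mu S) (phiG phi x)) as N.
simpl in *; unfold nu'; simpl in *.
rewrite <- (comp_assoc _ (fmap S (phiG phi x)) (fmap S (fmap G (mu T x)))).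
rewrite <- fmap_comp; simpl; rewrite E, !fmap_comp, !comp_assoc, <- A.
f_equal; rewrite <- !comp_assoc; f_equal; symmetry; exact N.
Qed.

Lemma nu'_eta (x : D) :
  nu'_trans x ∘ fmap (S ○ G) (eta T x) = idm ((S ○ G) x).
Proof.
pose proof (phiG_eta phi x) as E.
simpl in *; unfold nu'; simpl in *.
rewrite <- comp_assoc, <- fmap_comp; simpl; rewrite E; apply mu_etar.
Qed.

Definition SG_module : ModCat T C :=
  {| mod_fun := S ○ G;
     mod_act := nu'_trans;
     mod_act_mu := nu'_mu;
     mod_act_eta := nu'_eta |}.

Lemma nu'_algP (x : D) :
  nu' x ∘ mu S (G (T x)) = mu S (G x) ∘ fmap S (nu' x).
Proof.
pose proof (mu_assoc S (G x)) as A.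
pose proof (ntc_nat (mu S) (phiG phi x)) as N.
unfold nu'; simpl in *; rewrite fmap_comp, comp_assoc, <- A, <- !comp_assoc.
f_equal; symmetry; exact N.
Qed.

Definition pair_nu (X : EM T) :
  Hom (free_alg S (G (T (carrier X)))) (free_alg S (G (carrier X))) :=
  @Build_AlgHom C S (free_alg S (G (T (carrier X))))
    (free_alg S (G (carrier X))) (nu' (carrier X)) (nu'_algP (carrier X)).

Definition pair_act (X : EM T) :
  Hom (free_alg S (G (T (carrier X)))) (free_alg S (G (carrier X))) :=
  free_alg_map S (fmap G (action X)).

Lemma pair_reflexive (X : EM T) : is_reflexive_pair (pair_nu X) (pair_act X).
Proof.
exists (free_alg_map S (fmap G (eta T (carrier X)))).
split; apply AlgHom_eq; simpl.
- apply nu'_eta.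
- pose proof (action_eta X) as E; simpl in E.
  rewrite <- !fmap_comp, E; apply fcomp_id.
Qed.

Variable HS : ReflexiveCoequalizers (EM S).

Definition phi_hat_coeq (X : EM T) : Coequalizer (pair_nu X) (pair_act X) :=
  HS (pair_reflexive X).

Definition phi_hat_proj (X : EM T) :
  Hom (free_alg S (G (carrier X))) (coeq (phi_hat_coeq X)) :=
  coeq_proj (phi_hat_coeq X).

Lemma phi_hat_mapP (X Y : EM T) (h : Hom X Y) :
  (phi_hat_proj Y ∘ free_alg_map S (fmap G (amor h))) ∘ pair_nu X =
  (phi_hat_proj Y ∘ free_alg_map S (fmap G (amor h))) ∘ pair_act X.
Proof.
assert (E1 : free_alg_map S (fmap G (amor h)) ∘ pair_nu X =
  pair_nu Y ∘ free_alg_map S (fmap G (fmap T (amor h)))).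
{ apply AlgHom_eq; simpl; symmetry; exact (nu'_nat (amor h)). }
assert (E2 : free_alg_map S (fmap G (amor h)) ∘ pair_act X =
  pair_act Y ∘ free_alg_map S (fmap G (fmap T (amor h)))).
{ apply AlgHom_eq; simpl; rewrite <- !fmap_comp; do 2 f_equal; apply amorP. }
rewrite <- !comp_assoc, E1, E2, !comp_assoc; f_equal; apply coeq_eq.
Qed.

Definition phi_hat_map (X Y : EM T) (h : Hom X Y) :
  Hom (coeq (phi_hat_coeq X)) (coeq (phi_hat_coeq Y)) :=
  coeq_desc (phi_hat_coeq X) (phi_hat_mapP h).

Lemma phi_hat_mapE (X Y : EM T) (h : Hom X Y) :
  phi_hat_map h ∘ phi_hat_proj X =
  phi_hat_proj Y ∘ free_alg_map S (fmap G (amor h)).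
Proof. apply coeq_descK. Qed.

Lemma phi_hat_id (X : EM T) : phi_hat_map (idm X) = idm _.
Proof.
apply coeq_uniq; fold (phi_hat_proj X); rewrite phi_hat_mapE, comp_idl.
transitivity (phi_hat_proj X ∘ idm _); [f_equal|apply comp_idr].
apply AlgHom_eq; simpl; apply fcomp_id.
Qed.

Lemma phi_hat_comp (X Y Z : EM T) (g : Hom Y Z) (f : Hom X Y) :
  phi_hat_map (g ∘ f) = phi_hat_map g ∘ phi_hat_map f.
Proof.
apply coeq_uniq; fold (phi_hat_proj X).
rewrite <- comp_assoc, !phi_hat_mapE, comp_assoc, phi_hat_mapE, <- comp_assoc.
f_equal; apply AlgHom_eq; simpl; apply fcomp_comp.
Qed.

Definition phi_hat : Functor (EM T) (EM S) :=
  {| fobj := fun X => coeq (phi_hat_coeq X);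
     fmap := phi_hat_map;
     fmap_id := phi_hat_id;
     fmap_comp := phi_hat_comp |}.

End PhiHat.

(* Main.v *)
Require Import Defs.
From Stdlib Require Import IndefiniteDescription.

Set Implicit Arguments.
Unset Strict Implicit.
Unset Printing Implicit Defensive.

(** Write [x] for the carrier of a T-algebra with action [l].  The forgetful
    image of its [phi_hat] is a quotient of [S G x] by the pair [nu' x],
    [S G l], and both implications recognise such a quotient by splitting the
    pair in C; [coeq_proj_section_iso] turns a splitting into an isomorphism.

    Suppose [phi_hat] is [Q] on carriers.  On a free algebra [T x] the pair is
    [nu' (T x)], [S G (mu x)], which is split with quotient
    [nu' x : S G T x -> S G x]: this is the canonical presentation of the
    module [SG_module phi], and the splitting is made of units of T.  Hence
    [S G x] is isomorphic to [phi_hat (T x)], that is to [Q (T x)].  The action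
    [nu'] corresponds to [phi_hat (mu x)], that is to [Q (mu x)], so
    [SG_module phi] is the free module on [Q].

    Suppose conversely that [b] is an isomorphism from [SG_module phi] to the
    free module on [P].  It carries the pair to [P (mu x)], [P T l], which is
    the image under [P] of the canonical presentation of the algebra [x]; that
    presentation is split in D by units of T, so its image is split in C with
    quotient [P x].  The splitting lives in C only, so the S-algebra structure
    has first to be transported to [P x], as in the theorem of Beck
    ([split_quotient_alg]); then the quotient in EM S has carrier [P x]. *)

(** * Natural isomorphisms *)

Lemma nat_iso_inverse (C D : Category) (H K : Functor C D) (a : NatTrans H K) :
  (forall x, is_iso (a x)) ->
  exists b : NatTrans K H,
    forall x, b x ∘ a x = idm (H x) /\ a x ∘ b x = idm (K x).
Proof.
intros I.
pose (g := fun x => proj1_sig (constructive_indefinite_description _ (I x))).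
assert (gK : forall x, g x ∘ a x = idm (H x) /\ a x ∘ g x = idm (K x)).
{ intro x; exact (proj2_sig (constructive_indefinite_description _ (I x))). }
assert (N : forall x y (f : Hom x y), g y ∘ fmap K f = fmap H f ∘ g x).
{ intros x y f.
  rewrite <- (comp_idr (g y ∘ fmap K f)), <- (proj2 (gK x)), !comp_assoc.
  rewrite <- (comp_assoc (g y)), <- ntc_nat, comp_assoc.
  now rewrite (proj1 (gK y)), comp_idl. }
exists {| ntc := g; ntc_nat := N |}; exact gK.
Qed.

Lemma is_iso_comp (C : Category) (x y z : C) (g : Hom y z) (f : Hom x y) :
  is_iso g -> is_iso f -> is_iso (g ∘ f).
Proof.
intros [g' [g'g gg']] [f' [f'f ff']]; exists (f' ∘ g'); split.
- rewrite comp_assoc, <- (comp_assoc f'), g'g, comp_idr; exact f'f.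
- rewrite comp_assoc, <- (comp_assoc g), ff', comp_idr; exact gg'.
Qed.

Lemma TModHom_iso (D : Category) (T : Monad D) (C : Category)
  (M N : ModCat T C) (a : Hom M N) :
  (forall x, is_iso (modmor a x)) -> is_iso a.
Proof.
intros I; destruct (nat_iso_inverse I) as [b bK].
assert (B : forall x, mod_act M x ∘ b (T x) = b x ∘ mod_act N x).
{ intro x; pose proof (modmorP a x) as E.
  rewrite <- (comp_idr (b x ∘ mod_act N x)).
  change (idm ((mod_fun N ○ T) x)) with (idm (mod_fun N (T x))).
  rewrite <- (proj2 (bK (T x))), comp_assoc, <- (comp_assoc (b x)).
  simpl in *; rewrite E, comp_assoc, (proj1 (bK x)), comp_idl; reflexivity. }
exists {| modmor := b; modmorP := B |}.
split; apply TModHom_eq; intro x; apply bK.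
Qed.

Lemma TModHom_iso_inv (D : Category) (T : Monad D) (C : Category)
  (M N : ModCat T C) (a : Hom M N) (b : Hom N M) :
  b ∘ a = idm M -> forall x, modmor b x ∘ modmor a x = idm (mod_fun M x).
Proof.
intros E x.
change (modmor b x ∘ modmor a x) with (modmor (b ∘ a) x); now rewrite E.
Qed.

(** * Quotients of algebras that split in the base category *)

(** [e] and its lifts [S e], [S S e] are split epimorphisms, so the algebra laws
    of the quotient can be tested after precomposition with them. *)
Definition split_quotient_alg (C : Category) (S : Monad C) (B : Algebra S)
  (z : C) (e : Hom (carrier B) z) (s : Hom z (carrier B)) (a : Hom (S z) z)
  (es : e ∘ s = idm z) (ea : e ∘ action B = a ∘ fmap S e) : Algebra S.
Proof.
refine {| carrier := z; action := a |}.
- assert (L : (a ∘ mu S z) ∘ fmap S (fmap S e)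
              = (a ∘ fmap S a) ∘ fmap S (fmap S e)).
  { pose proof (ntc_nat (mu S) e) as N; pose proof (action_mu B) as A.
    simpl in N, A |- *.
    rewrite <- !comp_assoc, N, <- fmap_comp, <- ea.
    rewrite fmap_comp, !comp_assoc, <- ea.
    now rewrite <- !comp_assoc, A. }
  apply (f_equal (fun k => k ∘ fmap S (fmap S s))) in L.
  rewrite <- !(comp_assoc _ (fmap S (fmap S e))) in L.
  rewrite <- !fmap_comp, es, !fmap_id in L.
  exact (eq_trans (eq_sym (comp_idr _)) (eq_trans L (comp_idr _))).
- pose proof (ntc_nat (eta S) e) as N; pose proof (action_eta B) as A.
  simpl in N, A |- *.
  rewrite <- (comp_idr (comp _ _)), <- es.
  rewrite comp_assoc, <- (comp_assoc a), N, comp_assoc, <- ea.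
  rewrite <- (comp_assoc e), A, comp_idr; reflexivity.
Defined.

(** Let [p] be the projection of the coequalizer.  The section [s] need not be
    a morphism of algebras, but [p ∘ s] is one, because it is the map induced
    by [p] along the split epimorphism [e]; the map induced by [e] on the
    coequalizer is its inverse. *)
Lemma coeq_proj_section_iso (C : Category) (S : Monad C) (A B Z : EM S)
  (f g : Hom A B) (q : Coequalizer f g) (e : Hom B Z)
  (s : Hom (carrier Z) (carrier B)) :
  e ∘ f = e ∘ g ->
  amor e ∘ s = idm (carrier Z) ->
  amor (coeq_proj q) ∘ s ∘ amor e = amor (coeq_proj q) ->
  is_iso (amor (coeq_proj q) ∘ s).
Proof.
intros ef es pse.
assert (H : (amor (coeq_proj q) ∘ s) ∘ action Z
  = action (coeq q) ∘ fmap S (amor (coeq_proj q) ∘ s)).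
{ pose proof (amorP e) as Pe; pose proof (amorP (coeq_proj q)) as Pp.
  rewrite <- (comp_idr (_ ∘ action Z)), <- fmap_id, <- es, fmap_comp.
  rewrite !comp_assoc, <- (comp_assoc _ (action Z)), <- Pe, comp_assoc, pse.
  now rewrite Pp, fmap_comp, comp_assoc. }
pose (r := {| amor := amor (coeq_proj q) ∘ s; amorP := H |} : Hom Z (coeq q)).
pose (d := coeq_desc q ef).
assert (dp : amor d ∘ amor (coeq_proj q) = amor e).
{ exact (f_equal (@amor _ _ _ _) (coeq_descK q ef)). }
assert (rd : r ∘ d = idm (coeq q)).
{ apply coeq_uniq, AlgHom_eq; simpl.
  now rewrite <- comp_assoc, dp, pse, comp_idl. }
exists (amor d); split.
- now rewrite comp_assoc, dp.
- exact (f_equal (@amor _ _ _ _) rd).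
Qed.

(** Since [S] preserves the splitting, [e ∘ action B] coequalizes [S f] and
    [S g] and so factors through [S e].  This makes [z] an algebra and [e] a
    morphism of algebras, as [coeq_proj_section_iso] requires. *)
Lemma split_pair_coeq_iso (C : Category) (S : Monad C) (A B : EM S)
  (f g : Hom A B) (q : Coequalizer f g) (z : C) (e : Hom (carrier B) z)
  (s : Hom z (carrier B)) (t : Hom (carrier B) (carrier A)) :
  e ∘ amor f = e ∘ amor g ->
  e ∘ s = idm z ->
  amor f ∘ t = idm (carrier B) ->
  amor g ∘ t = s ∘ e ->
  is_iso (amor (coeq_proj q) ∘ s).
Proof.
intros ef es ft gt.
(* The action on [z] is forced: transport along [s], act, and project. *)
assert (ea : e ∘ action B = (e ∘ action B ∘ fmap S s) ∘ fmap S e).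
{ pose proof (amorP f) as Pf; pose proof (amorP g) as Pg.
  rewrite <- comp_assoc, <- fmap_comp, <- gt, fmap_comp, comp_assoc.
  rewrite <- (comp_assoc e), <- Pg, comp_assoc, <- ef.
  rewrite <- (comp_assoc e), Pf, <- !comp_assoc, <- fmap_comp, ft.
  now rewrite fmap_id, comp_idr. }
pose (Z := split_quotient_alg es ea : EM S).
pose (e' := @Build_AlgHom C S B Z e ea : Hom B Z).
apply (@coeq_proj_section_iso C S A B Z f g q e' s).
- apply AlgHom_eq; exact ef.
- exact es.
- simpl; rewrite <- comp_assoc, <- gt, comp_assoc.
  pose proof (f_equal (@amor _ _ _ _) (coeq_eq q)) as E; simpl in E.
  now rewrite <- E, <- comp_assoc, ft, comp_idr.
Qed.

(** * The functor phi_hat and free modules *)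

Section PhiHatFree.
Variables (C D : Category) (G : Functor D C) (F : Functor C D).
Variables (Psi : Adjunction G F) (S : Monad C) (T : Monad D).
Variables (HS : ReflexiveCoequalizers (EM S)) (phi : PsiMorphism Psi S T).

Lemma phi_hat_proj_nat (X Y : EM T) (h : Hom X Y) :
  amor (phi_hat_map phi HS h) ∘ amor (phi_hat_proj phi HS X) =
  amor (phi_hat_proj phi HS Y) ∘ fmap S (fmap G (amor h)).
Proof. exact (f_equal (@amor _ _ _ _) (phi_hat_mapE phi HS h)). Qed.

Lemma phi_hat_proj_eq (X : EM T) :
  amor (phi_hat_proj phi HS X) ∘ nu' phi (carrier X) =
  amor (phi_hat_proj phi HS X) ∘ fmap S (fmap G (action X)).
Proof. exact (f_equal (@amor _ _ _ _) (coeq_eq (phi_hat_coeq phi HS X))). Qed.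

(** The functor [phi_hat] takes the free algebra on [x] to the free algebra on
    [G x]; this is the isomorphism on carriers. *)
Definition phi_hat_unit (x : D) :
  Hom (S (G x)) (carrier (phi_hat phi HS (free_alg T x))) :=
  amor (phi_hat_proj phi HS (free_alg T x)) ∘ fmap S (fmap G (eta T x)).

(** Naturality of [nu'] moves the unit past [nu' x], where it meets
    [S G (mu x)] and cancels. *)
Lemma phi_hat_unit_nu' (x : D) :
  phi_hat_unit x ∘ nu' phi x = amor (phi_hat_proj phi HS (free_alg T x)).
Proof.
unfold phi_hat_unit.
pose proof (nu'_nat phi (eta T x)) as N; simpl in N.
pose proof (phi_hat_proj_eq (free_alg T x)) as E; simpl in E.
pose proof (mu_etar T x) as M; simpl in M.
simpl; rewrite <- comp_assoc, <- N, comp_assoc, E.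
rewrite <- comp_assoc, <- !fmap_comp, M, !fmap_id; apply comp_idr.
Qed.

(** The quotient is [nu' x] with section [S G (eta x)]: the module axioms of
    [SG_module phi] say that it coequalizes and splits. *)
Lemma phi_hat_unit_iso (x : D) : is_iso (phi_hat_unit x).
Proof.
pose (e := @Build_AlgHom C S (free_alg S (G (T x))) (free_alg S (G x))
  (nu' phi x) (nu'_algP phi x)
  : Hom (free_alg S (G (T x))) (free_alg S (G x))).
apply (coeq_proj_section_iso (e := e)).
- apply AlgHom_eq; exact (nu'_mu phi x).
- exact (nu'_eta phi x).
- exact (phi_hat_unit_nu' x).
Qed.

Lemma phi_hat_unit_nat (x y : D) (f : Hom x y) :
  phi_hat_unit y ∘ fmap S (fmap G f) =
  amor (phi_hat_map phi HS (free_alg_map T f)) ∘ phi_hat_unit x.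
Proof.
unfold phi_hat_unit.
pose proof (ntc_nat (eta T) f) as N; simpl in N.
rewrite comp_assoc, phi_hat_proj_nat; simpl.
now rewrite <- !comp_assoc, <- !fmap_comp, N.
Qed.

(** The functor [phi_hat] sends this morphism to the action of [SG_module phi],
    up to [phi_hat_unit]: see [phi_hat_unit_act]. *)
Definition mu_hom (x : D) : Hom (free_alg T (T x)) (free_alg T x) :=
  @Build_AlgHom D T (free_alg T (T x)) (free_alg T x) (mu T x) (mu_assoc T x).

(** Both sides are the projection of the coequalizer, the left one because the
    unit of T cancels [mu x]. *)
Lemma phi_hat_unit_act (x : D) :
  amor (phi_hat_map phi HS (mu_hom x)) ∘ phi_hat_unit (T x) =
  phi_hat_unit x ∘ nu' phi x.
Proof.
pose proof (mu_etal T x) as M; simpl in M.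
rewrite phi_hat_unit_nu'; unfold phi_hat_unit at 1.
rewrite comp_assoc, phi_hat_proj_nat; simpl.
rewrite <- comp_assoc, <- !fmap_comp, M, !fmap_id; apply comp_idr.
Qed.

Lemma SG_module_free (Q : Functor D C)
  (alpha : NatTrans (em_forget S ○ phi_hat phi HS) (Q ○ em_forget T)) :
  (forall X : EM T, is_iso (alpha X)) ->
  isomorphic (ModCat T C) (SG_module phi) (free_module T Q).
Proof.
intros I.
pose (c := fun x : D => (alpha (free_alg T x) ∘ phi_hat_unit x
  : Hom ((S ○ G) x) ((Q ○ T) x))).
assert (N : forall x y (f : Hom x y),
  c y ∘ fmap (S ○ G) f = fmap (Q ○ T) f ∘ c x).
{ intros x y f; unfold c.
  pose proof (phi_hat_unit_nat f) as U.
  pose proof (ntc_nat alpha (free_alg_map T f)) as A.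
  simpl in *; rewrite <- comp_assoc, U, !comp_assoc; f_equal; exact A. }
pose (n := {| ntc := c; ntc_nat := N |}).
assert (M : forall x, mod_act (free_module T Q) x ∘ n (T x) =
  n x ∘ mod_act (SG_module phi) x).
{ intro x; simpl; unfold c.
  pose proof (phi_hat_unit_act x) as U.
  pose proof (ntc_nat alpha (mu_hom x)) as A.
  simpl in *; rewrite <- (comp_assoc _ _ (nu' phi x)), <- U, !comp_assoc.
  f_equal; symmetry; exact A. }
exists (@Build_TModHom D T C (SG_module phi) (free_module T Q) n M).
apply TModHom_iso; intro x; apply is_iso_comp.
- apply I.
- apply phi_hat_unit_iso.
Qed.

Lemma phi_hat_of_free (P : Functor D C) :
  isomorphic (ModCat T C) (SG_module phi) (free_module T P) ->
  exists alpha : NatTrans (em_forget S ○ phi_hat phi HS) (P ○ em_forget T),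
    forall X : EM T, is_iso (alpha X).
Proof.
intros [b [b' [b'b bb']]].
pose proof (TModHom_iso_inv b'b) as K; pose proof (TModHom_iso_inv bb') as K'.
pose proof (modmorP b) as M.
pose proof (fun x y (f : Hom x y) => ntc_nat (modmor b) f) as N.
pose proof (fun x y (f : Hom x y) => ntc_nat (modmor b') f) as N'.
set (m := modmor b) in *; set (m' := modmor b') in *; simpl in K, K', M, N, N'.
pose (s := fun X : EM T => (m' (carrier X) ∘ fmap P (eta T (carrier X))
  : Hom (P (carrier X)) (S (G (carrier X))))).
pose (r := fun X : EM T => (amor (phi_hat_proj phi HS X) ∘ s X
  : Hom ((P ○ em_forget T) X) ((em_forget S ○ phi_hat phi HS) X))).
assert (R : forall X Y (h : Hom X Y), r Y ∘ fmap (P ○ em_forget T) h =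
  fmap (em_forget S ○ phi_hat phi HS) h ∘ r X).
{ intros X Y h; unfold r, s; simpl.
  pose proof (ntc_nat (eta T) (amor h)) as E; simpl in E.
  pose proof (phi_hat_proj_nat h) as H; simpl in H.
  rewrite (comp_assoc (amor (phi_hat_map phi HS h))), H.
  rewrite <- !comp_assoc; f_equal.
  rewrite !comp_assoc, <- N', <- !comp_assoc; f_equal.
  now rewrite <- !fmap_comp, E. }
assert (I : forall X, is_iso (r X)).
{ intros [x l Am Ae].
  pose proof (ntc_nat (eta T) l) as E; pose proof (mu_etal T x) as Me.
  simpl in Am, Ae, E, Me.
  (* The splitting of the pair [P (mu x)], [P T l] by units, conjugated by the
     module isomorphism. *)
  apply (split_pair_coeq_iso (phi_hat_coeq phi HS (Build_Algebra Am Ae))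
           (e := fmap P l ∘ m x)
           (t := m' (T x) ∘ (fmap P (eta T (T x)) ∘ m x))); simpl.
  - rewrite <- !comp_assoc, <- M, N, !comp_assoc, <- !fmap_comp, Am.
    reflexivity.
  - unfold s; simpl.
    rewrite comp_assoc, <- (comp_assoc (fmap P l)), K', comp_idr.
    rewrite <- fmap_comp, Ae; apply fmap_id.
  - (* The equation is tested after the monomorphism [m x]. *)
    rewrite <- (comp_idl (nu' phi x ∘ _)), <- (K x), <- !comp_assoc.
    rewrite (comp_assoc (m x)), <- M, <- (comp_assoc _ (m (T x))).
    rewrite (comp_assoc (m (T x))), K', comp_idl.
    rewrite (comp_assoc (fmap P (mu T x))), <- fmap_comp, Me, fmap_id.
    rewrite comp_idl; reflexivity.
  - unfold s; simpl.
    rewrite !comp_assoc, <- N', <- !comp_assoc; f_equal.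
    rewrite !comp_assoc, <- !fmap_comp, E; reflexivity. }
pose (rho := {| ntc := r; ntc_nat := R |}).
destruct (nat_iso_inverse (a := rho) I) as [alpha aK].
exists alpha; intro X; exists (rho X); destruct (aK X); split; assumption.
Qed.

End PhiHatFree.

Theorem theorem3p7 (C D : Category) (G : Functor D C) (F : Functor C D)
  (Psi : Adjunction G F) (S : Monad C) (T : Monad D)
  (HS : ReflexiveCoequalizers (EM S)) (HT : ReflexiveCoequalizers (EM T))
  (phi : PsiMorphism Psi S T) :
  (exists (Q : Functor D C)
     (alpha : NatTrans (em_forget S ○ phi_hat phi HS) (Q ○ em_forget T)),
     forall X : EM T, is_iso (alpha X))
  <->
  (exists P : Functor D C,
     isomorphic (ModCat T C) (SG_module phi) (free_module T P)).
Proof.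
split.
- intros [Q [alpha I]]; exists Q; exact (SG_module_free I).
- intros [P I]; exists P; exact (phi_hat_of_free HS I).
Qed.
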